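(* Let $A\in\mathbb{R}^{m\times n}$, $C\in\mathbb{R}^{p\times n}$, $b\in\mathbb{R}^m$, $d\in\mathbb{R}^p$, and let $G=A^{\mathsf T}A+C^{\mathsf T}C$. Consider the problem $$\min_{x\in\mathcal S}\|Ax-b\|_2,\qquad \mathcal S=\{x\in\mathbb{R}^n:\ \|Cx-d\|_2=\min\}. \quad (\ast)$$ Then the minimum 2-norm solution of $(\ast)$ is $$x^\dagger = C_A^\dagger d+\bigl(\mathcal P_{\mathcal R(G)}-C_A^\dagger C\bigr)A^\dagger b,$$ and the set of all solutions of $(\ast)$ is $x^\dagger+\mathcal N(G)$.
   Context: $\mathcal N(\cdot)$ and $\mathcal R(\cdot)$ denote null space and range; $\mathcal P_{\mathcal S}$ is the orthogonal projection (in the Euclidean inner product) onto a subspace $\mathcal S$; $M^\dagger$ is the Moore–Penrose pseudoinverse of a matrix $M$. The set $\mathcal S$ in $(\ast)$ is the set of all minimizers of $x\mapsto\|Cx-d\|_2$ over $\mathbb{R}^n$. The weighted pseudoinverse of $C$ with respect to $A$ is $C_A^\dagger:=\bigl(\mathrm I-(A\mathcal P_{\mathcal N(C)})^\dagger A\bigr)C^\dagger\in\mathbb{R}^{n\times p}$. The minimum 2-norm solution is the solution of smallest Euclidean norm. *)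

(* Defs.v *)
From HB Require Import structures.
From mathcomp Require Import all_boot all_order all_algebra.
From mathcomp Require Import boolp classical_sets reals.

Set Implicit Arguments.
Unset Strict Implicit.
Unset Printing Implicit Defensive.

Import Order.TTheory GRing.Theory Num.Theory.
Local Open Scope classical_set_scope.
Local Open Scope ring_scope.

Definition dotv (R : realType) (n : nat) (x y : 'cV[R]_n) : R :=
  \sum_(i < n) x i 0 * y i 0.

(* The norm [`|x|] that MathComp-Analysis puts on matrices is the sup norm. *)
Definition norm2 (R : realType) (n : nat) (x : 'cV[R]_n) : R :=
  Num.sqrt (dotv x x).

Definition argmin (R : realType) (T : Type) (f : T -> R) (D : set T) : set T :=
  [set x | D x /\ forall y, D y -> f x <= f y].

(* Matrices act on column vectors, so these are subspaces of column vectors,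
   unlike [kermx] and the row spaces of mxalgebra. *)
Definition nullspace (R : realType) (m n : nat) (M : 'M[R]_(m, n)) :
  {vspace 'cV[R]_n} := lker (linfun (mulmx M : 'cV[R]_n -> 'cV[R]_m)).

Definition rangespace (R : realType) (m n : nat) (M : 'M[R]_(m, n)) :
  {vspace 'cV[R]_m} := limg (linfun (mulmx M : 'cV[R]_n -> 'cV[R]_m)).

Definition is_orthoproj (R : realType) (n : nat) (S : {vspace 'cV[R]_n})
    (P : 'M[R]_n) : Prop :=
  forall x, P *m x \in S /\ forall y, y \in S -> dotv (x - P *m x) y = 0.

(* [is_orthoproj S] holds of exactly one matrix: see [orthoprojP] and
   [is_orthoproj_inj]; the default [0] is never taken. *)
Definition orthoproj (R : realType) (n : nat) (S : {vspace 'cV[R]_n}) : 'M[R]_n :=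
  xget 0 [set P | is_orthoproj S P].

(* The four Penrose equations. *)
Definition is_MPinv (R : realType) (m n : nat) (M : 'M[R]_(m, n))
    (X : 'M[R]_(n, m)) : Prop :=
  [/\ M *m X *m M = M, X *m M *m X = X,
      (M *m X)^T = M *m X & (X *m M)^T = X *m M].

(* [is_MPinv M] holds of exactly one matrix: see [MPinvP] and [is_MPinv_inj].
   MathComp's [pinvmx] is a generalized inverse, but in general not the
   Moore-Penrose one. *)
Definition MPinv (R : realType) (m n : nat) (M : 'M[R]_(m, n)) : 'M[R]_(n, m) :=
  xget 0 [set X | is_MPinv M X].

Definition wpinv (R : realType) (m n p : nat) (A : 'M[R]_(m, n))
    (C : 'M[R]_(p, n)) : 'M[R]_(n, p) :=
  (1%:M - MPinv (A *m orthoproj (nullspace C)) *m A) *m MPinv C.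

Definition lsq (R : realType) (p n : nat) (C : 'M[R]_(p, n)) (d : 'cV[R]_p) :
  set 'cV[R]_n := argmin (fun x => norm2 (C *m x - d)) [set: 'cV[R]_n].

Definition constrained_lsq (R : realType) (m n p : nat) (A : 'M[R]_(m, n))
    (C : 'M[R]_(p, n)) (b : 'cV[R]_m) (d : 'cV[R]_p) : set 'cV[R]_n :=
  argmin (fun x => norm2 (A *m x - b)) (lsq C d).

Section WellDefined.
Variable R : realType.

Lemma dotvE n (x y : 'cV[R]_n) : dotv x y = (x^T *m y) 0 0.
Proof. by rewrite mxE; apply: eq_bigr => i _; rewrite mxE. Qed.

Lemma dotvBl n (x y z : 'cV[R]_n) : dotv (x - y) z = dotv x z - dotv y z.
Proof. by rewrite -sumrB; apply: eq_bigr => i _; rewrite !mxE mulrBl. Qed.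

Lemma dotv_eq0 n (x : 'cV[R]_n) : dotv x x = 0 -> x = 0.
Proof.
move=> /eqP; rewrite psumr_eq0 => [|i _]; last by rewrite -expr2 sqr_ge0.
move=> /allP x0; apply/colP => i; rewrite mxE; apply/eqP.
by have := x0 i (mem_index_enum i); rewrite /= mulf_eq0 orbb.
Qed.

Lemma mem_nullspace m n (M : 'M[R]_(m, n)) (x : 'cV[R]_n) :
  (x \in nullspace M) = (M *m x == 0).
Proof. by rewrite memv_ker lfunE. Qed.

Lemma mem_rangespaceP m n (M : 'M[R]_(m, n)) (x : 'cV[R]_m) :
  reflect (exists y : 'cV[R]_n, x = M *m y) (x \in rangespace M).
Proof.
apply: (iffP memv_imgP) => [[y _ ->]|[y ->]]; exists y; rewrite ?lfunE//.
by rewrite memvf.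
Qed.

Lemma gram_unit r n (K : 'M[R]_(r, n)) : row_free K -> K *m K^T \in unitmx.
Proof.
move=> Kfree; rewrite -row_free_unit; apply/inj_row_free => v vKK.
have /dotv_eq0 : dotv (v *m K)^T (v *m K)^T = 0.
  by rewrite dotvE trmxK trmx_mul !mulmxA -(mulmxA v) vKK mul0mx mxE.
move=> /(congr1 trmx); rewrite trmxK trmx0 => vK.
by apply/eqP; rewrite -(mulmx_free_eq0 _ Kfree) vK.
Qed.

Lemma is_MPinv_ex m n (M : 'M[R]_(m, n)) : exists X, is_MPinv M X.
Proof.
move: (\rank M) (col_base M) (row_base M) (mulmx_base M)
  (row_base_free M) (col_base_full M) => r B K /esym EM Kfree Bfull.
have uK : K *m K^T \in unitmx by exact: gram_unit.
have uB : B^T *m B \in unitmx.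
  by rewrite -{2}[B]trmxK; apply: gram_unit; rewrite /row_free mxrank_tr.
have tK : (invmx (K *m K^T))^T = invmx (K *m K^T).
  by rewrite trmx_inv trmx_mul trmxK.
have tB : (invmx (B^T *m B))^T = invmx (B^T *m B).
  by rewrite trmx_inv trmx_mul trmxK.
pose L := K^T *m invmx (K *m K^T); pose N := invmx (B^T *m B) *m B^T.
have KL : K *m L = 1%:M by rewrite /L mulmxA mulmxV.
have NB : N *m B = 1%:M by rewrite /N -mulmxA mulVmx.
exists (L *m N); rewrite EM.
have E1 : B *m K *m (L *m N) = B *m N by rewrite -mulmxA (mulmxA K) KL mul1mx.
have E2 : L *m N *m (B *m K) = L *m K by rewrite -mulmxA (mulmxA N) NB mul1mx.
rewrite /is_MPinv E1 E2; split.
- by rewrite -mulmxA (mulmxA N) NB mul1mx.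
- by rewrite -mulmxA (mulmxA K) KL mul1mx.
- by rewrite /N !trmx_mul trmxK tB mulmxA.
- by rewrite /L !trmx_mul trmxK tK mulmxA.
Qed.

Lemma is_MPinv_inj m n (M : 'M[R]_(m, n)) X Y :
  is_MPinv M X -> is_MPinv M Y -> X = Y.
Proof.
move=> [x1 x2 x3 x4] [y1 y2 y3 y4].
have MXY : M *m X = M *m Y.
  rewrite -{1}y1 -!mulmxA mulmxA -[LHS]trmxK trmx_mul x3 y3.
  by rewrite mulmxA x1 y3.
have XYM : X *m M = Y *m M.
  rewrite -{1}y1 -mulmxA mulmxA -[LHS]trmxK trmx_mul x4 y4.
  by rewrite -mulmxA (mulmxA M) x1 y4.
by rewrite -x2 XYM -mulmxA MXY mulmxA y2.
Qed.

Lemma MPinvP m n (M : 'M[R]_(m, n)) : is_MPinv M (MPinv M).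
Proof. by have [X MX] := is_MPinv_ex M; exact: (xgetI 0 MX). Qed.

Lemma is_orthoproj_ex n (S : {vspace 'cV[R]_n}) : exists P, is_orthoproj S P.
Proof.
pose B : 'M[R]_(n, \dim S) := \matrix_(i, j) (vbasis S)`_j i 0.
have BE c : B *m c = \sum_(j < \dim S) c j 0 *: (vbasis S)`_j.
  apply/colP => i; rewrite mxE summxE; apply: eq_bigr => j _.
  by rewrite !mxE mulrC.
have BS c : B *m c \in S.
  rewrite BE; apply: memv_suml => j _; apply: memvZ; apply: vbasis_mem.
  by apply: mem_nth; rewrite size_tuple.
have SB y : y \in S -> exists c, y = B *m c.
  move=> /coord_vbasis yE; exists (\col_j coord (vbasis S) j y).
  by rewrite {1}yE BE; apply: eq_bigr => j _; rewrite mxE.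
have [p1 _ p3 _] := MPinvP B.
exists (B *m MPinv B) => x; split=> [|y /SB[c ->]].
  by rewrite -mulmxA BS.
rewrite dotvE linearB /= trmx_mul p3 mulmxBl !mulmxA.
by rewrite -!mulmxA (mulmxA B) (mulmxA (B *m _)) p1 subrr mxE.
Qed.

Lemma is_orthoproj_inj n (S : {vspace 'cV[R]_n}) P Q :
  is_orthoproj S P -> is_orthoproj S Q -> P = Q.
Proof.
move=> hP hQ.
have PQ (x : 'cV[R]_n) : P *m x = Q *m x.
  apply/eqP; rewrite -subr_eq0; apply/eqP; apply: dotv_eq0.
  have [Px oP] := hP x; have [Qx oQ] := hQ x.
  have zS := rpredB Px Qx; have := oQ _ zS; have := oP _ zS.
  set z := P *m x - Q *m x => oPz oQz.
  have zE : z = (x - Q *m x) - (x - P *m x).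
    by rewrite opprB addrC addrA subrK.
  by rewrite {1}zE dotvBl oPz oQz subrr.
apply/matrixP => i j; have := PQ (delta_mx j 0).
by rewrite -!colE => /colP/(_ i); rewrite !mxE.
Qed.

Lemma orthoprojP n (S : {vspace 'cV[R]_n}) : is_orthoproj S (orthoproj S).
Proof. by have [P SP] := is_orthoproj_ex S; exact: (xgetI 0 SP). Qed.

End WellDefined.

(* Main.v *)
(* Write [P] for the orthogonal projection onto N(C) and [B = A P]. Affine least
   squares is Pythagoras: if the residual at [x0] is orthogonal to [M K], the
   minimizers of ||M x - c|| over [x0 + K] are [x0 + K] intersected with
   [x0 + N(M)]. Applied with [K] the whole space and [x0 = C^+ d], this gives
   the least squares set [x0 + N(C)]. Put [xd = x0 + B^+ (b - A x0)]. Applied at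
   [xd] with [K = N(C)] and then [K = N(G)], it gives the solution set of the
   constrained problem and its element of least norm. That [xd] is the vector of
   the theorem follows from [C^+ C = 1 - P], [B^+ A A^+ = B^+] and
   [P - B^+ B = P_{N(G)} = 1 - P_{R(G)}]. *)
Require Import Defs.
From mathcomp Require Import all_boot all_order all_algebra.
From mathcomp Require Import boolp classical_sets reals.

Set Implicit Arguments.
Unset Strict Implicit.
Unset Printing Implicit Defensive.

Import Order.TTheory GRing.Theory Num.Theory.
Local Open Scope classical_set_scope.
Local Open Scope ring_scope.

(** * Euclidean geometry and least squares on affine subspaces *)

Section InnerProduct.
Context {R : realType}.

Lemma dotvC n (x y : 'cV[R]_n) : dotv x y = dotv y x.
Proof. by apply: eq_bigr => i _; rewrite mulrC. Qed.

Lemma dotvDl n (x y z : 'cV[R]_n) : dotv (x + y) z = dotv x z + dotv y z.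
Proof. by rewrite !dotvE linearD mulmxDl mxE. Qed.

Lemma dotvDr n (x y z : 'cV[R]_n) : dotv z (x + y) = dotv z x + dotv z y.
Proof. by rewrite !dotvE mulmxDr mxE. Qed.

Lemma dotv0 n (x : 'cV[R]_n) : dotv x 0 = 0.
Proof. by rewrite dotvE mulmx0 mxE. Qed.

Lemma dotv_mulmxl m n (M : 'M[R]_(m, n)) x y :
  dotv (M *m x) y = dotv x (M^T *m y).
Proof. by rewrite !dotvE trmx_mul mulmxA. Qed.

Lemma dotv_ge0 n (x : 'cV[R]_n) : 0 <= dotv x x.
Proof. by apply: sumr_ge0 => i _; rewrite -expr2 sqr_ge0. Qed.

Lemma norm2_le n (x y : 'cV[R]_n) :
  (norm2 x <= norm2 y) = (dotv x x <= dotv y y).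
Proof. by rewrite /norm2 ler_sqrt // dotv_ge0. Qed.

Lemma dotv_pythagoras n (x y : 'cV[R]_n) : dotv x y = 0 ->
  dotv (x + y) (x + y) = dotv x x + dotv y y.
Proof. by move=> xy; rewrite dotvDl !dotvDr (dotvC y x) xy addr0 add0r. Qed.

(** Same image set as in the theorem, so the solution set found in this form is the claimed one by
    conversion. *)
Definition affine n (x : 'cV[R]_n) (K : {vspace 'cV[R]_n}) : set 'cV[R]_n :=
  [set x + z | z in [set` K]].

Lemma affineE n (x y : 'cV[R]_n) (K : {vspace 'cV[R]_n}) :
  affine x K y <-> y - x \in K.
Proof.
split=> [[z Kz <-]|Kyx]; first by rewrite addrAC subrr add0r.
by exists (y - x); rewrite // addrC subrK.
Qed.

Lemma eq_affine n (x y : 'cV[R]_n) (K : {vspace 'cV[R]_n}) :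
  y - x \in K -> affine x K = affine y K.
Proof.
move=> Kyx; apply/seteqP; split=> z /affineE Kz; apply/affineE.
  by rewrite -(subrK x z) -addrA -(opprB y) rpredB.
by rewrite -(subrK y z) -addrA rpredD.
Qed.

Lemma affine0 n (x : 'cV[R]_n) : affine x 0%VS = [set x].
Proof.
apply/seteqP; split=> y; first by move/affineE; rewrite memv0 subr_eq0 => /eqP.
by move->; apply/affineE; rewrite subrr mem0v.
Qed.

Lemma affineT n (x : 'cV[R]_n) : affine x fullv = [set: 'cV[R]_n].
Proof. by apply/seteqP; split=> // y _; apply/affineE; rewrite memvf. Qed.

Lemma argmin_affine k n (M : 'M[R]_(k, n)) c x0 (K : {vspace 'cV[R]_n}) :
    (forall z, z \in K -> dotv (M *m x0 - c) (M *m z) = 0) ->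
  argmin (fun x => norm2 (M *m x - c)) (affine x0 K) =
  affine x0 (K :&: nullspace M).
Proof.
move=> orth.
have pyth z : z \in K -> dotv (M *m (x0 + z) - c) (M *m (x0 + z) - c) =
    dotv (M *m x0 - c) (M *m x0 - c) + dotv (M *m z) (M *m z).
  by move=> Kz; rewrite mulmxDr addrAC dotv_pythagoras ?orth.
apply/seteqP; split=> [_ [[z Kz <-] zmin]|_ [z KMz <-]] /=.
  (* Comparing the minimizer with the base point [x0] leaves no room for a nonzero [M *m z]. *)
  have /zmin : affine x0 K x0 by apply/affineE; rewrite subrr mem0v.
  rewrite norm2_le pyth // gerDl => z_le0.
  exists z => //=; rewrite memv_cap Kz mem_nullspace.
  by apply/eqP/dotv_eq0/eqP; rewrite eq_le z_le0 dotv_ge0.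
have : z \in (K :&: nullspace M)%VS by exact: KMz.
rewrite memv_cap => /andP[Kz]; rewrite mem_nullspace => /eqP Mz.
split=> [|_ [y Ky <-]]; first by exists z.
by rewrite norm2_le !pyth // Mz dotv0 addr0 lerDl dotv_ge0.
Qed.

End InnerProduct.

(** * Orthogonal projections expressed through the pseudoinverse *)

Section Pseudoinverse.
Context {R : realType}.

(** With e_i the unit vectors, e_i - P e_i is orthogonal to P e_j; entrywise this says P = P^T P,
    which is symmetric. *)
Lemma tr_orthoproj n (S : {vspace 'cV[R]_n}) : (orthoproj S)^T = orthoproj S.
Proof.
have SP := orthoprojP S; set P := orthoproj S in SP *.
suff E : P = P^T *m P by rewrite E trmx_mul trmxK.
apply/matrixP => i j.
have /eqP := (SP (delta_mx i 0)).2 _ (SP (delta_mx j 0)).1.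
rewrite dotvBl subr_eq0 dotv_mulmxl mulmxA !dotvE trmx_delta -!rowE -!colE.
by rewrite !mxE => /eqP.
Qed.

Lemma orthoproj_id n (S : {vspace 'cV[R]_n}) y :
  y \in S -> orthoproj S *m y = y.
Proof.
move=> Sy; have [SPy oPy] := orthoprojP S y.
by apply/esym/eqP; rewrite -subr_eq0; apply/eqP/dotv_eq0/oPy/rpredB.
Qed.

Lemma eq_mulmx_cV m n (M N : 'M[R]_(m, n)) :
  (forall x : 'cV_n, M *m x = N *m x) -> M = N.
Proof.
move=> MN; apply/matrixP => i j.
by have /colP/(_ i) := MN (delta_mx j 0); rewrite -!colE !mxE.
Qed.

Lemma orthoproj_idem n (S : {vspace 'cV[R]_n}) :
  orthoproj S *m orthoproj S = orthoproj S.
Proof.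
apply: eq_mulmx_cV => x; rewrite -mulmxA orthoproj_id //.
by have [] := orthoprojP S x.
Qed.

Lemma mulmx_orthoproj_nullspace m n (M : 'M[R]_(m, n)) :
  M *m orthoproj (nullspace M) = 0.
Proof.
apply: eq_mulmx_cV => x; rewrite -mulmxA mul0mx.
by have [+ _] := orthoprojP (nullspace M) x; rewrite mem_nullspace => /eqP.
Qed.

Lemma orthoproj_nullspaceP m n (M : 'M[R]_(m, n)) (P : 'M[R]_n) :
    P^T = P -> M *m P = 0 -> (forall y : 'cV_n, M *m y = 0 -> P *m y = y) ->
  orthoproj (nullspace M) = P.
Proof.
move=> tP MP Pid; apply: is_orthoproj_inj (orthoprojP _) _ => x.
split=> [|y]; rewrite mem_nullspace; first by rewrite mulmxA MP mul0mx.
by move=> /eqP/Pid Py; rewrite dotvBl dotv_mulmxl tP Py subrr.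
Qed.

Lemma orthoproj_nullspace m n (M : 'M[R]_(m, n)) :
  orthoproj (nullspace M) = 1%:M - MPinv M *m M.
Proof.
have [p1 p2 p3 p4] := MPinvP M; apply: orthoproj_nullspaceP.
- by rewrite linearB /= trmx1 p4.
- by rewrite mulmxBr mulmx1 mulmxA p1 subrr.
- by move=> y My; rewrite mulmxBl mul1mx -mulmxA My mulmx0 subr0.
Qed.

Lemma orthoproj_rangespace m n (M : 'M[R]_(m, n)) :
  orthoproj (rangespace M) = M *m MPinv M.
Proof.
have [p1 p2 p3 p4] := MPinvP M; apply: is_orthoproj_inj (orthoprojP _) _ => x.
split=> [|_ /mem_rangespaceP[y ->]].
  by apply/mem_rangespaceP; exists (MPinv M *m x); rewrite mulmxA.
by rewrite dotvBl dotv_mulmxl p3 mulmxA p1 subrr.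
Qed.

Lemma MPinv_tr m n (M : 'M[R]_(m, n)) : MPinv M^T = (MPinv M)^T.
Proof.
have [p1 p2 p3 p4] := MPinvP M; apply: is_MPinv_inj (MPinvP _) _.
by split; rewrite -!trmx_mul ?trmxK ?mulmxA ?p1 ?p2 ?p3 ?p4.
Qed.

(** The pseudoinverse of a symmetric matrix is symmetric, so [M] commutes with [MPinv M]. *)
Lemma orthoproj_rangespace_sym n (M : 'M[R]_n) : M^T = M ->
  orthoproj (rangespace M) = 1%:M - orthoproj (nullspace M).
Proof.
move=> tM; have [_ _ _ p4] := MPinvP M.
rewrite orthoproj_rangespace orthoproj_nullspace opprB addrC subrK.
by rewrite -p4 trmx_mul -MPinv_tr !tM.
Qed.

(* [R(M^+) = R(M^T)] and [N(M^+) = N(M^T)]. *)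
Lemma MPinv_factorl m n (M : 'M[R]_(m, n)) :
  MPinv M = M^T *m (MPinv M)^T *m MPinv M.
Proof. by have [_ p2 _ p4] := MPinvP M; rewrite -trmx_mul p4 p2. Qed.

Lemma MPinv_factorr m n (M : 'M[R]_(m, n)) :
  MPinv M = MPinv M *m (MPinv M)^T *m M^T.
Proof.
by have [_ p2 p3 _] := MPinvP M; rewrite -mulmxA -trmx_mul p3 mulmxA p2.
Qed.

(** By symmetry of M M^+, M^T M M^+ = (M M^+ M)^T = M^T. This supplies the orthogonality that
    [argmin_affine] asks for, with [C] and then with [B] as [M]. *)
Lemma MPinv_normal_eq m n (M : 'M[R]_(m, n)) (c : 'cV_m) :
  M^T *m (M *m MPinv M *m c - c) = 0.
Proof.
have [p1 _ p3 _] := MPinvP M.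
by rewrite mulmxBr mulmxA -{1}p3 -trmx_mul p1 subrr.
Qed.

(** Pair G x with x: the result is ||A x||^2 + ||C x||^2. *)
Lemma nullspace_gram m n p (A : 'M[R]_(m, n)) (C : 'M[R]_(p, n)) :
  nullspace (A^T *m A + C^T *m C) = (nullspace C :&: nullspace A)%VS.
Proof.
apply/vspaceP => x; rewrite memv_cap !mem_nullspace.
apply/eqP/andP => [Gx|[/eqP Cx /eqP Ax]]; last first.
  by rewrite mulmxDl -!mulmxA Ax Cx !mulmx0 addr0.
have /eqP : dotv (A *m x) (A *m x) + dotv (C *m x) (C *m x) = 0.
  by rewrite !dotv_mulmxl -dotvDr !mulmxA -mulmxDl Gx dotv0.
rewrite paddr_eq0 ?dotv_ge0 // => /andP[/eqP/dotv_eq0 -> /eqP/dotv_eq0 ->].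
by rewrite !eqxx.
Qed.

End Pseudoinverse.

(** * The pseudoinverse of [A] restricted to N(C) *)

Section WeightedPseudoinverse.
Context {R : realType} {m n p : nat} (A : 'M[R]_(m, n)) (C : 'M[R]_(p, n)).

Let P := orthoproj (nullspace C).
Let B := A *m P.
Let G := A^T *m A + C^T *m C.

(** The range of B^+ is that of B^T = P A^T, hence inside N(C). *)
Lemma orthoproj_MPinv_restr : P *m MPinv B = MPinv B.
Proof.
by rewrite (MPinv_factorl B) trmx_mul tr_orthoproj !mulmxA orthoproj_idem.
Qed.

Lemma mulmx_MPinv_restr : C *m MPinv B = 0.
Proof.
by rewrite -orthoproj_MPinv_restr mulmxA mulmx_orthoproj_nullspace mul0mx.
Qed.

(** A A^+ is symmetric and fixes R(A), which contains R(B); so B^T A A^+ = B^T, and B^+ factors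
    through B^T. *)
Lemma MPinv_restr_proj : MPinv B *m (A *m MPinv A) = MPinv B.
Proof.
have [p1 _ p3 _] := MPinvP A.
rewrite (MPinv_factorr B) -[LHS]mulmxA; congr (_ *m _).
by rewrite -p3 -trmx_mul mulmxA p1.
Qed.

(** B^+ B projects onto R(B^T), a subspace of N(C); removing it from P leaves the part of N(C) that
    A kills. *)
Lemma orthoproj_nullspace_gram : orthoproj (nullspace G) = P - MPinv B *m B.
Proof.
have [p1 _ _ p4] := MPinvP B.
have CD : C *m (P - MPinv B *m B) = 0.
  rewrite mulmxBr mulmxA mulmx_MPinv_restr mul0mx.
  by rewrite mulmx_orthoproj_nullspace subrr.
have AD : A *m (P - MPinv B *m B) = 0.
  by rewrite mulmxBr mulmxA -orthoproj_MPinv_restr (mulmxA A P) p1 subrr.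
apply: orthoproj_nullspaceP; first by rewrite linearB /= p4 tr_orthoproj.
  by rewrite mulmxDl -!mulmxA CD AD !mulmx0 addr0.
move=> y /eqP; rewrite -mem_nullspace nullspace_gram memv_cap => /andP[Cy].
rewrite mem_nullspace => /eqP Ay.
by rewrite mulmxBl -!mulmxA orthoproj_id // Ay mulmx0 subr0.
Qed.

Lemma orthoproj_sub_wpinv :
  orthoproj (rangespace G) - wpinv A C *m C = MPinv B *m A.
Proof.
rewrite orthoproj_rangespace_sym; last first.
  by rewrite /G linearD /= !trmx_mul !trmxK.
have -> : wpinv A C *m C = (1%:M - MPinv B *m A) *m (1%:M - P).
  have -> : 1%:M - P = MPinv C *m C by rewrite /P orthoproj_nullspace subKr.
  by rewrite mulmxA.
(* Now (1 - P + B^+ B) - (1 - P - B^+ A + B^+ B) collapses to B^+ A. *)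
rewrite orthoproj_nullspace_gram mulmxBr mulmx1 mulmxBl mul1mx -mulmxA -/B.
by rewrite !opprB !addrA (addrAC 1%:M (- _)) (addrAC _ (- (_ *m A))) subKr.
Qed.

End WeightedPseudoinverse.

Theorem theorem3p2 (R : realType) (m n p : nat)
    (A : 'M[R]_(m, n)) (C : 'M[R]_(p, n)) (b : 'cV[R]_m) (d : 'cV[R]_p) :
  let G := A^T *m A + C^T *m C in
  let xd := wpinv A C *m d
            + (orthoproj (rangespace G) - wpinv A C *m C) *m (MPinv A *m b) in
  argmin (@norm2 R n) (constrained_lsq A C b d) = [set xd] /\
  constrained_lsq A C b d = [set xd + z | z in [set` nullspace G]].
Proof.
move=> G xd; pose P := orthoproj (nullspace C); pose B := A *m P.
pose x0 := MPinv C *m d.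
have xdE : xd = x0 + MPinv B *m (b - A *m x0).
  rewrite /xd orthoproj_sub_wpinv -/P -/B !mulmxA.
  rewrite -(mulmxA _ A) MPinv_restr_proj.
  rewrite /wpinv -/P -/B mulmxBl mul1mx mulmxBl -!mulmxA -/x0 mulmxBr.
  by rewrite -addrA (addrC (- _)).
have PB : P *m MPinv B = MPinv B := orthoproj_MPinv_restr A C.
have lsqE : lsq C d = affine xd (nullspace C).
  rewrite /lsq -(affineT x0) argmin_affine ?capfv => [|z _].
    (* As C B^+ = 0, the correction in [xd] lies in N(C), so [xd] may replace [x0] as base point. *)
    apply: eq_affine; rewrite xdE addrAC subrr add0r mem_nullspace mulmxA.
    by rewrite mulmx_MPinv_restr mul0mx.
  by rewrite dotvC dotv_mulmxl /x0 mulmxA MPinv_normal_eq dotv0.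
have solE : constrained_lsq A C b d = affine xd (nullspace G).
  rewrite /constrained_lsq lsqE nullspace_gram argmin_affine // => z Cz.
  (* On N(C), A z = A P z = B z, so the normal equation of [B] applies. *)
  rewrite -(orthoproj_id Cz) -/P mulmxA -/B dotvC dotv_mulmxl.
  have -> : A *m xd - b = B *m MPinv B *m (b - A *m x0) - (b - A *m x0).
    rewrite xdE mulmxDr mulmxA -(mulmxA A P) PB.
    by rewrite opprB addrA (addrC (A *m x0)).
  by rewrite MPinv_normal_eq dotv0.
split; last exact: solE.
rewrite solE.
(* The norm is itself a least squares objective, with identity matrix and zero target. *)
have -> : @norm2 R n = fun x => norm2 (1%:M *m x - 0).
  by apply: funext => x; rewrite mul1mx subr0.
rewrite argmin_affine => [|z]; last first.
  rewrite nullspace_gram memv_cap !mem_nullspace => /andP[/eqP Cz /eqP Az].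
  have Bz : B *m z = 0.
    by rewrite -mulmxA orthoproj_id ?mem_nullspace ?Cz ?Az.
  (* Both terms of [xd] lie in R(C^T) and R(B^T), while [C] and [B] vanish on N(G). *)
  rewrite !mul1mx subr0 xdE dotvDl /x0 (MPinv_factorl C) (MPinv_factorl B).
  rewrite -!(mulmxA _^T) !dotv_mulmxl !trmxK.
  by rewrite Cz Bz !mulmx0 !dotv0 addr0.
have -> : (nullspace G :&: nullspace (1%:M : 'M[R]_n))%VS = 0%VS.
  apply/vspaceP => z; rewrite memv_cap !mem_nullspace mul1mx memv0.
  by rewrite andb_idl // => /eqP ->; rewrite mulmx0.
exact: affine0.
Qed.
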